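(* Let $f_1,\dots,f_m:\mathbb{R}^n\to\mathbb{R}$ be convex and continuously differentiable, each $\nabla f_i$ being $L_i$-Lipschitz continuous for a given $L_i\ge0$, and set $L=\max_{i=1,\dots,m}L_i$. Let $g(z)=\max(z_1,\dots,z_m)$ for $z\in\mathbb{R}^m$ and $F=(f_1,\dots,f_m)$. Assume that $g\circ F=\max_{i}f_i$ has a minimizer, and let $S=\mathrm{argmin}\,g\circ F$. Let $(x_k)_{k\in\mathbb{N}}$ be a sequence generated by the proximal Gauss-Newton method: $x_0\in\mathbb{R}^n$ and, for every $k\in\mathbb{N}$, $$x_{k+1}\in\underset{y\in\mathbb{R}^n}{\mathrm{argmin}}\ \max_{i\in\{1,\dots,m\}}\left\{f_i(x_k)+\nabla f_i(x_k)^T(y-x_k)\right\}+\frac{L}{2}\|y-x_k\|^2,$$ with $x_{k+1}=x_k$ whenever $x_k$ belongs to this argmin. Then for any $k\ge1$ and any $x_*\in S$, $$g(F(x_k))-g(F(x_* ))\le\frac{L}{2k}\|x_0-x_*\|^2,$$ and furthermore the sequence $(x_k)_{k\in\mathbb{N}}$ converges to a minimizer of $g\circ F$.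
   Context: $\|\cdot\|$ is the Euclidean norm on $\mathbb{R}^n$. *)

(* Defs.v *)
From mathcomp Require Import all_boot all_order all_algebra.
From mathcomp Require Import boolp classical_sets reals topology normedtype derive convex.
Set Implicit Arguments.
Unset Strict Implicit.
Unset Printing Implicit Defensive.
Import Order.TTheory GRing.Theory Num.Theory.
Import numFieldNormedType.Exports.
Local Open Scope classical_set_scope.
Local Open Scope ring_scope.

(* R^n is 'rV[R]_n.  The norm `|x| of the library on 'rV[R]_n is the sup norm;
   it induces the usual topology of R^n, and is used here only through that
   topology (limits, continuity, differentiability). *)

Definition dot (R : realType) (n : nat) (u v : 'rV[R]_n) : R :=
  \sum_(i < n) u 0 i * v 0 i.

Definition enorm (R : realType) (n : nat) (u : 'rV[R]_n) : R :=
  Num.sqrt (dot u u).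

Definition grad (R : realType) (n : nat) (f : 'rV[R]_n -> R) (x : 'rV[R]_n) :
  'rV[R]_n := \row_(j < n) 'D_(delta_mx 0 j) f x.

Definition cont_diff (R : realType) (n : nat) (f : 'rV[R]_n -> R) : Prop :=
  (forall x, differentiable f x) /\ continuous (grad f).

Definition elipschitz (R : realType) (n p : nat) (c : R)
    (h : 'rV[R]_n -> 'rV[R]_p) : Prop :=
  forall x y, enorm (h x - h y) <= c * enorm (x - y).

(* The dimension is positive, so that the maximum exists; starting the
   iteration from the coordinate z 0 0 does not change its value. *)
Definition maxcoord (R : realType) (m : nat) (z : 'rV[R]_m.+1) : R :=
  \big[Num.max/z 0 0]_(i < m.+1) z 0 i.

Definition argmin (R : realType) (T : Type) (h : T -> R) : set T :=
  [set y | forall z, h y <= h z].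

Definition pgn_model (R : realType) (n m : nat) (f : 'I_m.+1 -> 'rV[R]_n -> R)
    (L : R) (x y : 'rV[R]_n) : R :=
  maxcoord (\row_i (f i x + dot (grad (f i) x) (y - x)))
  + L / 2 * enorm (y - x) ^+ 2.

Definition pgn_sequence (R : realType) (n m : nat)
    (f : 'I_m.+1 -> 'rV[R]_n -> R) (L : R) (x : nat -> 'rV[R]_n) : Prop :=
  forall k, argmin (pgn_model f L (x k)) (x k.+1) /\
    (argmin (pgn_model f L (x k)) (x k) -> x k.+1 = x k).

(* Main.v *)
(** Write [phi] for the maximum of the [f i] and [M u] for the Gauss-Newton model
    at [u].  Convexity and the descent lemma give
    [phi <= M u <= phi + L/2 |. - u|^2], and [M u] is [L]-strongly convex, so
    its minimizer [v] satisfies, for every [z],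
    [phi v + L/2 |v - z|^2 <= phi z + L/2 |u - z|^2].
    With [z := u] this says that [phi] decreases along the sequence; with [z] a
    minimizer of [phi] it telescopes to the rate and, if [L > 0], yields
    Fejer monotonicity, hence convergence by Opial's argument.  If [L = 0] the
    model is exact and the method stops after one step. *)
Require Import Defs.
From mathcomp Require Import all_boot all_order all_algebra.
From mathcomp Require Import boolp classical_sets reals topology normedtype derive convex.
From mathcomp Require Import functions interval_inference realfun ring lra.
Import Order.TTheory GRing.Theory Num.Theory.
Import numFieldNormedType.Exports.
Local Open Scope classical_set_scope.
Local Open Scope ring_scope.

(** * Euclidean inner product and norm, and their comparison with the sup norm *)

Section Euclidean.
Context {R : realType} {n : nat}.
Implicit Types u v w : 'rV[R]_n.

Lemma dotC u v : dot u v = dot v u.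
Proof. by apply: eq_bigr => i _; rewrite mulrC. Qed.

Lemma dotDr u v w : dot u (v + w) = dot u v + dot u w.
Proof. by rewrite -big_split; apply: eq_bigr => i _; rewrite mxE mulrDr. Qed.

Lemma dotZr (a : R) u v : dot u (a *: v) = a * dot u v.
Proof. by rewrite /dot mulr_sumr; apply: eq_bigr => i _; rewrite mxE mulrCA. Qed.

Lemma dotBr u v w : dot u (v - w) = dot u v - dot u w.
Proof. by rewrite dotDr -scaleN1r dotZr mulN1r. Qed.

Lemma dotDl u v w : dot (u + v) w = dot u w + dot v w.
Proof. by rewrite dotC dotDr !(dotC w). Qed.

Lemma dotZl (a : R) u v : dot (a *: u) v = a * dot u v.
Proof. by rewrite dotC dotZr dotC. Qed.

Lemma dotBl u v w : dot (u - v) w = dot u w - dot v w.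
Proof. by rewrite dotC dotBr !(dotC w). Qed.

Lemma dot_ge0 u : 0 <= dot u u.
Proof. by apply: sumr_ge0 => i _; rewrite -expr2 sqr_ge0. Qed.

Lemma enorm_ge0 u : 0 <= enorm u.
Proof. exact: sqrtr_ge0. Qed.

Lemma sqr_enorm u : enorm u ^+ 2 = dot u u.
Proof. by rewrite sqr_sqrtr// dot_ge0. Qed.

Lemma enorm0 : enorm (0 : 'rV[R]_n) = 0.
Proof. by rewrite /enorm -(scale0r 0) dotZr mul0r sqrtr0. Qed.

Lemma enormC u v : enorm (u - v) = enorm (v - u).
Proof. by rewrite /enorm !dotBr !dotBl (dotC v u); congr Num.sqrt; ring. Qed.

Lemma enormZ (a : R) u : enorm (a *: u) = `|a| * enorm u.
Proof. by rewrite /enorm dotZr dotZl mulrA sqrtrM -?expr2 ?sqr_ge0// sqrtr_sqr. Qed.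

Lemma coord_le_enorm u i : `|u 0 i| <= enorm u.
Proof.
rewrite -sqrtr_sqr ler_wsqrtr// expr2 /dot (bigD1 i)//= lerDl.
by apply: sumr_ge0 => j _; rewrite -expr2 sqr_ge0.
Qed.

Lemma enorm_eq0 u : enorm u = 0 -> u = 0.
Proof.
move=> u0; apply/rowP => i; rewrite mxE; apply/eqP.
by rewrite -normr_eq0 eq_le normr_ge0 andbT -u0 coord_le_enorm.
Qed.

(** Cauchy-Schwarz, by expanding [|b u - a v|^2 >= 0] with [a = |u|] and [b = |v|], then cancelling
    [a b]; hence the separate cases [a = 0] and [b = 0]. *)
Lemma dot_le_enorm u v : dot u v <= enorm u * enorm v.
Proof.
have [u0|u0] := eqVneq (enorm u) 0.
  by rewrite u0 (enorm_eq0 _ u0) -(scale0r 0) dotZl !mul0r.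
have [v0|v0] := eqVneq (enorm v) 0.
  by rewrite v0 (enorm_eq0 _ v0) -(scale0r 0) dotZr mulr0 mul0r.
have uv : 0 < enorm u * enorm v by rewrite mulr_gt0// lt0r ?u0 ?v0 enorm_ge0.
have := dot_ge0 (enorm v *: u - enorm u *: v).
rewrite !dotBr !dotBl !dotZr !dotZl -!sqr_enorm (dotC v u) => H.
rewrite -(ler_pM2l uv); lra.
Qed.

Lemma mx_norm_le_enorm u : `|u| <= enorm u.
Proof.
rewrite [leLHS]mx_normrE; apply: bigmax_le; first exact: enorm_ge0.
by case=> i j _ /=; rewrite ord1 coord_le_enorm.
Qed.

Lemma enorm_le_mx_norm u : enorm u <= Num.sqrt n%:R * `|u|.
Proof.
rewrite -[`|u|]normr_id -sqrtr_sqr -sqrtrM ?ler0n// ler_wsqrtr//.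
rewrite mulr_natl -[X in _ *+ X](card_ord n) -sumr_const.
apply: ler_sum => i _; rewrite -expr2 -real_normK ?num_real//.
rewrite ler_pXn2r ?nnegrE// [leRHS]mx_normrE.
exact: (le_bigmax _ _ (0, i)).
Qed.

End Euclidean.

(** * The maximum of the coordinates as a least upper bound *)

Section MaxCoord.
Context {R : realType} {m : nat}.
Implicit Types z : 'rV[R]_m.+1.

Lemma maxcoord_leP z (c : R) :
  reflect (forall i, z 0 i <= c) (maxcoord z <= c).
Proof.
apply: (iffP (bigmax_leP _ _ _ _)) => [[_ + i]|zc]; first exact.
by split=> [|i _]; exact: zc.
Qed.

Lemma coord_le_maxcoord z i : z 0 i <= maxcoord z.
Proof. by move: i; apply/maxcoord_leP. Qed.

End MaxCoord.

(** * First-order bounds: tangent planes from below, quadratics from above *)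

Section ConvexDiff.
Context {R : realType} {n : nat}.
Implicit Types (f : 'rV[R]_n -> R) (x y d : 'rV[R]_n).

Lemma derive_grad f x d : differentiable f x -> 'D_d f x = dot (grad f x) d.
Proof.
move=> df; rewrite deriveE// {1}[d]row_sum_delta linear_sum.
apply: eq_bigr => i _ /=; rewrite linearZ/= mxE deriveE//.
by rewrite mulrC.
Qed.

Lemma is_derive_line f x d (t : R) : (forall y, differentiable f y) ->
  is_derive t 1 (fun s : R => f (s *: d + x)) (dot (grad f (t *: d + x)) d).
Proof.
move=> df; have := derivableP (@diff_derivable _ _ _ _ _ d (df (t *: d + x))).
rewrite derive_grad// => -[D V].
have E : (fun h : R => h^-1 *: (((fun s : R => f (s *: d + x)) \o shift t) (h *: (1 : R)) - f (t *: d + x)))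
       = (fun h : R => h^-1 *: ((f \o shift (t *: d + x)) (h *: d) - f (t *: d + x))).
  apply: funext => h; congr (_ *: (f _ - _)).
  by rewrite /= addrA -scalerDl [_ *: 1]mulr1.
by split; [rewrite /derivable E | rewrite /derive E; exact: V].
Qed.

(** For [0 < h <= 1], convexity bounds the difference quotient at [x] in the direction [y - x] by
    [f y - f x]; let [h] tend to [0] from the right. *)
Lemma convex_gradient_le f x y : convex_function [set: 'rV[R]_n] f ->
  differentiable f x -> f x + dot (grad f x) (y - x) <= f y.
Proof.
move=> cf df; rewrite addrC -lerBrDr -derive_grad//.
have D := @diff_derivable _ _ _ _ _ (y - x) df.
apply: (cvgr_to_le (cvg_dnbhs_at_right D)).
near=> h.
have h0 : 0 < h by near: h; exact: nbhs_right_gt.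
have h1 : h <= 1 by near: h; apply: nbhs_right_ltW.
rewrite [leLHS]mulrC ler_pdivrMr//=.
have := cf (Itv01 (ltW h0) h1) y x (in_setT _) (in_setT _).
rewrite convRE/= /conv/= /unstable.onem => fh.
have -> : h *: (y - x) + x = h *: y + (1 - h) *: x.
  by rewrite scalerBr scalerBl scale1r -addrA (addrC _ x).
lra.
Unshelve. all: by end_near.
Qed.

(** The mean value theorem replaces integration of the gradient: subtracting [a t + b t^2] from [f]
    along the segment leaves a function [p] whose derivative is nonpositive on [(0, 1)], so
    [p 1 <= p 0]. *)
Lemma descent_lemma f (L : R) x y : (forall z, differentiable f z) ->
  elipschitz L (grad f) ->
  f y <= f x + dot (grad f x) (y - x) + L / 2 * enorm (y - x) ^+ 2.
Proof.
move=> df lip; set d := y - x; set a := dot (grad f x) d.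
set b := L / 2 * enorm d ^+ 2.
pose q (s : R) := f (s *: d + x).
pose p : R -> R := q - (a *: id + b *: (id ^+ 2)).
have pE t : p t = q t - (a * t + b * t ^+ 2) by [].
have dp (t : R) : is_derive t 1 p (dot (grad f (t *: d + x)) d - (a + 2 * b * t)).
  have dq : is_derive t 1 q _ := is_derive_line f x d t df.
  by apply: is_derive_eq; rewrite /GRing.scale/=; ring.
have pc : {within `[0, 1], continuous p}.
  by apply: derivable_within_continuous => t _; have [] := dp t.
have [c /[!in_itv]/= /andP[c0 c1]] := MVT ltr01 (fun t _ => dp t) pc.
have -> : p 1 = f y - (a + b).
  by rewrite pE /q scale1r subrK; ring.
have -> : p 0 = f x.
  by rewrite pE /q scale0r add0r; ring.
have : dot (grad f (c *: d + x) - grad f x) d <= L * (c * enorm d) * enorm d.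
  apply: le_trans (dot_le_enorm _ _) _.
  rewrite ler_wpM2r ?enorm_ge0// (le_trans (lip _ _))// addrK enormZ.
  by rewrite gtr0_norm.
by rewrite dotBl -/a /b; lra.
Qed.

End ConvexDiff.

(** * Euclidean convergence and Fejer monotone sequences *)

Lemma enorm_cvg {R : realType} {n : nat} (x : nat -> 'rV[R]_n) (p : 'rV[R]_n) :
  (forall e, 0 < e -> \forall k \near \oo, enorm (x k - p) < e) -> x @ \oo --> p.
Proof.
move=> xp; apply/cvgrPdist_lt => e e0; near=> k.
rewrite distrC (le_lt_trans (mx_norm_le_enorm _))//.
by near: k; exact: xp.
Unshelve. all: by end_near.
Qed.

Lemma nbhs_enorm {R : realType} {n : nat} (p : 'rV[R]_n) (e : R) : 0 < e ->
  \forall y \near p, enorm (y - p) < e.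
Proof.
move=> e0; have s0 : 0 < Num.sqrt n%:R + 1 :> R by rewrite ltr_wpDl.
near=> y; apply: le_lt_trans (enorm_le_mx_norm _) _.
apply: (@le_lt_trans _ _ ((Num.sqrt n%:R + 1) * `|y - p|)).
  by rewrite ler_wpM2r// lerDl.
rewrite mulrC -ltr_pdivlMr// distrC; near: y.
by apply: (cvgr_dist_lt _ _ cvg_id); exact: divr_gt0.
Unshelve. all: by end_near.
Qed.

(* Opial's argument: a cluster point p lies in S, so the distance of the
   sequence to p is nonincreasing, and it gets arbitrarily small. *)
Lemma fejer_cvg {R : realType} {n : nat} (S : set 'rV[R]_n) (x : nat -> 'rV[R]_n) :
  S !=set0 ->
  (forall s k, S s -> enorm (x k.+1 - s) <= enorm (x k - s)) ->
  cluster (x @ \oo) `<=` S ->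
  exists p, S p /\ x @ \oo --> p.
Proof.
move=> [s Ss] fejer clS.
have mono q k j : S q -> (k <= j)%N -> enorm (x j - q) <= enorm (x k - q).
  move=> Sq /subnK <-; elim: (j - k)%N => // i IH.
  exact: le_trans (fejer _ _ Sq) IH.
pose D := enorm (x 0%N - s).
(* By monotonicity the whole sequence stays in this box around [s], which is compact and so provides
   a cluster point. *)
pose K (i : 'I_n) : set R := [set` `[s 0 i - D, s 0 i + D]].
have cK : compact [set v : 'rV[R]_n | forall i, K i (v 0 i)].
  by apply: rV_compact => i; exact: segment_compact.
have xK : (x @ \oo) [set v : 'rV[R]_n | forall i, K i (v 0 i)].
  exists 0%N => // k _ /= i; rewrite /K/= in_itv/=.
  have := coord_le_enorm (x k - s) i; rewrite !mxE => xki.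
  have := le_trans xki (mono s 0%N k Ss (leq0n k)).
  by rewrite ler_norml -/D; lra.
have [p [_ clp]] := cK _ _ xK.
have Sp := clS _ clp.
exists p; split=> //; apply: enorm_cvg => e e0.
have [_ [[N _ <-] xNe]] : [set x k | k in [set: nat]] `&` [set y | enorm (y - p) < e] !=set0.
  by apply: clp; [exists 0%N => // k _; exists k | exact: nbhs_enorm].
by exists N => // k /= Nk; apply: le_lt_trans (mono _ _ _ Sp Nk) xNe.
Qed.

(** * Analysis of the proximal Gauss-Newton iteration *)

Section ProximalGaussNewton.
Context {R : realType} {n m : nat}.
Context (f : 'I_m.+1 -> 'rV[R]_n -> R) (L : R).
Implicit Types (x : nat -> 'rV[R]_n) (u v y z : 'rV[R]_n).

Let phi y := maxcoord (\row_i f i y).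

Let le_phi i y : f i y <= phi y.
Proof. by have := coord_le_maxcoord (\row_i f i y) i; rewrite mxE. Qed.

(* The model is L-strongly convex, so it grows quadratically away from its
   minimizer. *)
Lemma pgn_model_growth (u y z : 'rV[R]_n) : argmin (pgn_model f L u) y ->
  pgn_model f L u y + L / 2 * enorm (z - y) ^+ 2 <= pgn_model f L u z.
Proof.
move=> ymin; set c := L / 2 * _.
set My := pgn_model f L u y; set Mz := pgn_model f L u z.
have MyMz : My <= Mz by exact: ymin.
(* Compare [y] with the point [w] of the segment from [y] to [z]. The max part is convex, and
   [|(1-t)p + tq|^2 = (1-t)|p|^2 + t|q|^2 - t(1-t)|q-p|^2]; dividing by [t] gives the bound. *)
have key (t : R) : 0 < t -> t < 1 -> (1 - t) * c <= Mz - My.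
  move=> t0 t1; pose w := (1 - t) *: y + t *: z.
  have wE : w - u = (1 - t) *: (y - u) + t *: (z - u).
    by apply/rowP => i; rewrite !mxE; ring.
  have zyE : z - y = (z - u) - (y - u) by rewrite opprB addrA subrK.
  have := ymin w; rewrite -/My /pgn_model wE.
  rewrite /c /My /Mz /pgn_model zyE.
  set hy := maxcoord _; set hw := maxcoord _; set hz := maxcoord _.
  have hwle : hw <= (1 - t) * hy + t * hz.
    apply/maxcoord_leP => i; rewrite mxE dotDr !dotZr.
    have := coord_le_maxcoord _ i : _ <= hy.
    have := coord_le_maxcoord _ i : _ <= hz.
    rewrite !mxE; nra.
  move: hy hw hz hwle (y - u) (z - u) => hy hw hz hwle p q.
  rewrite !sqr_enorm !(dotBr, dotBl) !(dotDr, dotDl) !(dotZr, dotZl) (dotC q p).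
  move: (dot p p) (dot p q) (dot q q) => A B C H.
  rewrite -(ler_pM2l t0); nra.
rewrite -lerBrDl; case: (lerP c (Mz - My)) => // lt.
have c0 : 0 < c by lra.
have c2 : 0 < 2 * c by lra.
(* Instead of letting [t] tend to [0]: this [t] makes [(1 - t) c] the midpoint of [Mz - My] and [c],
   which contradicts [key] when [Mz - My < c]. *)
pose t := (c - (Mz - My)) / (2 * c).
have tc : t * c = (c - (Mz - My)) / 2 by rewrite /t; field; rewrite gt_eqF.
have t_gt0 : 0 < t by apply: divr_gt0 => //; lra.
have t_lt1 : t < 1 by rewrite ltr_pdivrMr//; lra.
by have := key _ t_gt0 t_lt1; rewrite mulrBl tc; lra.
Qed.

Hypothesis f_convex : forall i, convex_function [set: 'rV[R]_n] (f i).
Hypothesis f_diff : forall i y, differentiable (f i) y.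
Hypothesis f_lip : forall i, elipschitz L (grad (f i)).
Hypothesis L_ge0 : 0 <= L.

Lemma phi_le_pgn_model u y : phi y <= pgn_model f L u y.
Proof.
apply/maxcoord_leP => i; rewrite mxE /pgn_model.
apply: le_trans (descent_lemma _ L u y (f_diff i) (f_lip i)) _; rewrite lerD2r.
by have := coord_le_maxcoord (\row_i (f i u + dot (grad (f i) u) (y - u))) i; rewrite mxE.
Qed.

Lemma pgn_model_le_phi u y :
  pgn_model f L u y <= phi y + L / 2 * enorm (y - u) ^+ 2.
Proof.
rewrite /pgn_model lerD2r; apply/maxcoord_leP => i; rewrite mxE.
exact: le_trans (convex_gradient_le _ _ _ (f_convex i) (f_diff i u)) (le_phi i y).
Qed.

Lemma pgn_model_diag u : pgn_model f L u u = phi u.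
Proof.
apply/eqP; rewrite eq_le phi_le_pgn_model andbT.
by have := pgn_model_le_phi u u; rewrite subrr enorm0 expr0n mulr0 addr0.
Qed.

Lemma pgn_step u v z : argmin (pgn_model f L u) v ->
  phi v + L / 2 * enorm (v - z) ^+ 2 <= phi z + L / 2 * enorm (u - z) ^+ 2.
Proof.
move=> /(pgn_model_growth _ _ z); rewrite !(enormC _ z).
by have := phi_le_pgn_model u v; have := pgn_model_le_phi u z; lra.
Qed.

Lemma pgn_fejer u v s : 0 < L -> argmin phi s -> argmin (pgn_model f L u) v ->
  enorm (v - s) <= enorm (u - s).
Proof.
move=> L_gt0 smin /(pgn_step _ _ s) vs.
rewrite -(ler_pXn2r (n := 2)) ?nnegrE ?enorm_ge0//.
have L2 : 0 < L / 2 by lra.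
by rewrite -(ler_pM2l L2); have := smin v; lra.
Qed.

(** Multiplying by [k] and keeping the last distance term makes the induction telescope. *)
Lemma pgn_rate x z k : pgn_sequence f L x ->
  k%:R * (phi (x k) - phi z) <=
    L / 2 * enorm (x 0%N - z) ^+ 2 - L / 2 * enorm (x k - z) ^+ 2.
Proof.
move=> xpgn; elim: k => [|k IH]; first by rewrite mul0r subrr.
have decr : phi (x k.+1) <= phi (x k).
  have := pgn_step _ _ (x k) (xpgn k).1.
  rewrite subrr enorm0 expr0n mulr0 addr0; apply: le_trans.
  by rewrite lerDl mulr_ge0 ?sqr_ge0 ?divr_ge0.
(* Monotone decrease lets the newest value replace [phi (x k)] in the [k] gaps already summed. *)
have kdecr := ler_wpM2l (ler0n R k) decr.
by have := pgn_step _ _ z (xpgn k).1; rewrite -[k.+1%:R]natr1; lra.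
Qed.

(** The rate drives [phi (x k)] to the minimum; continuity of each [f i] carries the bound to the
    cluster point, one component at a time. *)
Lemma pgn_cluster x : pgn_sequence f L x -> argmin phi !=set0 ->
  cluster (x @ \oo) `<=` argmin phi.
Proof.
move=> xpgn [s smin] p clp y; apply: le_trans (smin y).
apply/ler_addgt0Pr => e e0; apply/maxcoord_leP => i; rewrite mxE.
pose C := L / 2 * enorm (x 0%N - s) ^+ 2.
have xle : \forall k \near \oo, phi (x k) < phi s + e / 2.
  near=> k.
  (* Past this index the rate bound [C / k] is below [e / 2]; the other half of [e] pays for the
     continuity of [f i] at [p]. *)
  have kC : C / (e / 2) < k%:R by near: k; exact: nbhs_infty_gtr.
  have k0 : (0 : R) < k%:R.
    apply: le_lt_trans kC; apply: divr_ge0; last by rewrite ltW// divr_gt0.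
    by rewrite mulr_ge0 ?sqr_ge0 ?divr_ge0.
  rewrite -ltrBlDl -(ltr_pM2l k0).
  apply: le_lt_trans (pgn_rate _ s k xpgn) _.
  have xk0 : 0 <= L / 2 * enorm (x k - s) ^+ 2 by rewrite mulr_ge0 ?sqr_ge0 ?divr_ge0.
  by move: kC; rewrite ltr_pdivrMr ?divr_gt0// /C; lra.
have fnear : \forall y \near p, `|f i p - f i y| < e / 2.
  have fcont : {for p, continuous (f i)} by exact: differentiable_continuous.
  by apply: (cvgr_dist_lt _ _ fcont); exact: divr_gt0.
have [y' [/= yle]] := clp [set y | phi y < phi s + e / 2] _ xle fnear.
by rewrite ltr_norml => /andP[_ fpy]; have := le_phi i y'; lra.
Unshelve. all: by end_near.
Qed.

(* Without curvature the model is exact, so x 1 is already a minimizer and the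
   stopping rule freezes the sequence. *)
Lemma pgn_stationary x s : L = 0 -> pgn_sequence f L x -> argmin phi s ->
  forall k, (0 < k)%N -> x k = x 1%N /\ argmin phi (x k).
Proof.
move=> L0 xpgn smin; have min k : argmin phi (x k.+1).
  move=> z; have := pgn_step _ _ z (xpgn k).1.
  by rewrite L0 !mul0r !addr0.
elim=> // -[|k] IH _; first by split.
have [xk _] := IH isT; split=> //; rewrite -xk.
(* The stopping rule applies because a minimizer of [phi] minimizes its own model: the model equals
   [phi] at its centre and majorizes it elsewhere. *)
apply: (xpgn k.+1).2 => z; rewrite pgn_model_diag.
exact: le_trans (min k z) (phi_le_pgn_model _ _).
Qed.

End ProximalGaussNewton.

(** * Rate and convergence for the constant [L] given by the largest [Li i] *)

Theorem corollary3 (R : realType) (n m : nat)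
    (f : 'I_m.+1 -> 'rV[R]_n -> R) (Li : 'I_m.+1 -> R) (x : nat -> 'rV[R]_n) :
  let L := maxcoord (\row_i Li i) in
  let F := fun y : 'rV[R]_n => \row_i f i y in
  let g := @maxcoord R m in
  let S := argmin (g \o F) in
  (forall i, convex_function [set: 'rV[R]_n] (f i)) ->
  (forall i, cont_diff (f i)) ->
  (forall i, 0 <= Li i) ->
  (forall i, elipschitz (Li i) (grad (f i))) ->
  S !=set0 ->
  pgn_sequence f L x ->
  (forall (k : nat) (xs : 'rV[R]_n), (1 <= k)%N -> S xs ->
     g (F (x k)) - g (F xs) <= L / (2 * k%:R) * enorm (x 0%N - xs) ^+ 2) /\
  (exists xs : 'rV[R]_n, S xs /\ x @ \oo --> xs).
Proof.
move=> L F g S fconv fC1 Li0 flip S0 xpgn.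
have fdiff i y : differentiable (f i) y by have [] := fC1 i.
have LiL i : Li i <= L by have := coord_le_maxcoord (\row_i Li i) i; rewrite mxE.
have L0 : 0 <= L := le_trans (Li0 ord0) (LiL ord0).
have flipL i : elipschitz L (grad (f i)).
  by move=> y z; rewrite (le_trans (flip i y z))// ler_wpM2r ?enorm_ge0.
split=> [k s k1 _|].
  have k0 : (0 : R) < k%:R by rewrite ltr0n.
  rewrite -(ler_pM2l k0).
  apply: le_trans (pgn_rate f L fconv fdiff flipL L0 x s k xpgn) _.
  rewrite -[leRHS]subr0; apply: lerB; last by rewrite mulr_ge0 ?sqr_ge0 ?divr_ge0.
  by rewrite le_eqVlt; apply/orP; left; apply/eqP; field; rewrite gt_eqF.
(* Fejer monotonicity comes from cancelling [L / 2], so [L = 0] is treated apart, through the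
   eventually constant sequence. *)
have [L_gt0|] := ltP 0 L.
  apply: fejer_cvg => // [s k Ss|].
    exact: (pgn_fejer f L fconv fdiff flipL _ _ _ L_gt0 Ss (xpgn k).1).
  exact: pgn_cluster.
move=> L_le0; have LE : L = 0 by apply/eqP; rewrite eq_le L_le0 L0.
have [s Ss] := S0.
have stat := pgn_stationary f L fconv fdiff flipL x s LE xpgn Ss.
exists (x 1%N); split; first exact: (stat 1%N isT).2.
apply: cvg_near_cst; exists 1%N => // k /= k1.
by have [->] := stat k k1.
Qed.
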